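(* Let $\mathcal{I}$ be a finite set and $\pi$ a probability measure on $\mathcal{I}$. Let $P=(p_{i,j})_{i,j\in\mathcal{I}}$ be an irreducible transition matrix that is reversible with respect to $\pi$, i.e. $\pi_i p_{i,j}=\pi_j p_{j,i}$ for all $i,j\in\mathcal{I}$. Suppose that at most one diagonal entry of $P$ is non-zero, and that the undirected graph $G=(V,E)$ corresponding to $P$ is acyclic. Let $P'$ be an irreducible transition matrix on $\mathcal{I}$ (not assumed reversible) with invariant distribution $\pi$ such that $\nu(f,P',\pi)\le \nu(f,P,\pi)$ for every real-valued function $f$ on $\mathcal{I}$. Then $P=P'$.
   Context: For a real-valued function $f$ on the finite set $\mathcal{I}$, write $\pi(f)=\sum_{i\in\mathcal{I}} f(i)\pi(i)$ and $\pi_i=\pi(i)$. For an irreducible transition matrix $P$ on $\mathcal{I}$ with invariant distribution $\pi$, let $(X_k)_{k\ge 0}$ be the Markov chain with transition matrix $P$ and initial distribution $\mu$. The asymptotic variance of $f$ is $$\nu(f,P,\pi)=\lim_{n\to\infty} n\,\mathbb{E}_\mu\Big[\Big(\frac1n\sum_{k=0}^{n-1}f(X_k)-\pi(f)\Big)^2\Big],$$ which does not depend on $\mu$. Equivalently, with $\langle f,g\rangle_\pi=\sum_{i\in\mathcal{I}} f(i)g(i)\pi(i)$ and $\Pi$ the matrix all of whose rows equal $\pi$, $$\nu(f,P,\pi)=2\big\langle [(I-P+\Pi)^{-1}-\Pi](f-\pi(f)),\,f-\pi(f)\big\rangle_\pi-\langle f-\pi(f),f-\pi(f)\rangle_\pi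 .$$ The undirected graph $G=(V,E)$ corresponding to a reversible transition matrix $P$ has vertex set $V=\mathcal{I}$, and $(i,j)\in E$ if and only if $p_{i,j}>0$. A cycle is a path that starts and ends at the same vertex with no other repeated vertices; in an undirected graph a cycle must contain at least 3 different vertices (so self-loops and back-and-forth traversals of one edge are not cycles). A graph is acyclic if it has no cycle. *)

(* Defs.v *)
From mathcomp Require Import all_boot all_order all_algebra.
From mathcomp Require Import all_classical reals topology normedtype sequences.
Import Order.TTheory GRing.Theory Num.Theory.
Import numFieldNormedType.Exports.

Set Implicit Arguments.
Unset Strict Implicit.
Unset Printing Implicit Defensive.

Local Open Scope classical_set_scope.
Local Open Scope ring_scope.

Definition is_distribution (R : realType) (I : finType) (p : I -> R) : Prop :=
  (forall i, 0 <= p i) /\ \sum_i p i = 1.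

Definition is_transition_matrix (R : realType) (I : finType)
    (P : I -> I -> R) : Prop :=
  forall i, is_distribution (P i).

Fixpoint nstep (R : realType) (I : finType) (P : I -> I -> R) (n : nat)
    (i j : I) : R :=
  if n is m.+1 then \sum_k P i k * nstep P m k j else (i == j)%:R.

Definition irreducible (R : realType) (I : finType) (P : I -> I -> R) : Prop :=
  forall i j, exists n : nat, 0 < nstep P n i j.

Definition reversible (R : realType) (I : finType) (p : I -> R)
    (P : I -> I -> R) : Prop :=
  forall i j, p i * P i j = p j * P j i.

Definition invariant_distribution (R : realType) (I : finType) (p : I -> R)
    (P : I -> I -> R) : Prop :=
  is_distribution p /\ forall j, \sum_i p i * P i j = p j.

Definition mean (R : realType) (I : finType) (p f : I -> R) : R :=
  \sum_i f i * p i.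

Fixpoint transition_prob (R : realType) (I : finType) (P : I -> I -> R)
    (x : I) (s : seq I) : R :=
  if s is y :: s' then P x y * transition_prob P y s' else 1.

(* The probability that (X_0, ..., X_{n-1}) = s, where n = size s and X is the
   Markov chain with transition matrix P and initial distribution mu. *)
Definition path_prob (R : realType) (I : finType) (mu : I -> R)
    (P : I -> I -> R) (s : seq I) : R :=
  if s is x :: s' then mu x * transition_prob P x s' else 1.

(* E_mu [F (X_0, ..., X_{n-1})]: the integrand depends only on the first n
   states, so the expectation is a finite sum against their joint law. *)
Definition chain_expectation (R : realType) (I : finType) (mu : I -> R)
    (P : I -> I -> R) (n : nat) (F : n.-tuple I -> R) : R :=
  \sum_(s : n.-tuple I) path_prob mu P s * F s.

(* For irreducible P with invariant distribution p, the limit exists and does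
   not depend on the initial distribution mu. *)
Definition asymptotic_variance (R : realType) (I : finType) (mu : I -> R)
    (f : I -> R) (P : I -> I -> R) (p : I -> R) : R :=
  lim ((fun n : nat => n%:R * chain_expectation mu P (fun s : n.-tuple I =>
    (n%:R^-1 * (\sum_(k < n) f (tnth s k)) - mean p f) ^+ 2)) @ \oo).

Definition edge (R : realType) (I : finType) (P : I -> I -> R) : rel I :=
  fun i j => 0 < P i j.

(* The closing vertex of a cycle is not repeated in c.  The bound on the size
   discards self-loops and back-and-forth traversals of one edge; acyclicity of
   an undirected graph is meant, so e is expected to be symmetric. *)
Definition acyclic (I : finType) (e : rel I) : Prop :=
  forall c : seq I, (2 < size c)%N -> ~ ucycle e c.

(* Main.v *)
(** Since a centred f has a solution g of the Poisson equation (I - P) g = f,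
the martingale decomposition of sum_k f(X_k) gives
nu(f, P, pi) = 2 <f, g> - <f, f>. Writing L = I - P and L' = I - P', the
hypothesis therefore says <L g, v> <= <L g, g> whenever L' v = L g.

P is a weighted tree. Let A be the branch at j cut off by the edge j - i, let g
be the indicator of A and f = L g, a function carried by i and j. If P' agrees
with P on all rows and columns of A other than j, then comparing P and P' on A
yields <f, v> >= <f, g>, so the hypothesis is an equality at g. Its first
variation says that v + v* - 2 g is constant, where v* solves the Poisson
equation of the time reversal of P'. By the maximum principle v and v* are both
maximal at j and minimal at i, hence both equal g up to a constant, and so P'
agrees with P on row and column j too. Starting from the leaves this determines
every row and column except those of a root, chosen to carry the possibly
non-zero diagonal entry. *)

Require Import Defs.
From HB Require Import structures.
From mathcomp Require Import all_boot all_order all_algebra.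
From mathcomp Require Import all_classical reals topology normedtype sequences.
From mathcomp Require Import ring lra.
Import Order.TTheory GRing.Theory Num.Theory.
Import numFieldNormedType.Exports.
Local Open Scope ring_scope.

(** * Transition operators: maximum principle and Poisson equation *)

Definition stepop (R : realType) (I : finType) (P : I -> I -> R) (h : I -> R)
    (i : I) : R := \sum_j P i j * h j.

Arguments stepop {R I} P h i.

Section TransitionMatrix.
Set Implicit Arguments.
Unset Strict Implicit.
Variables (R : realType) (I : finType) (P : I -> I -> R).
Hypothesis hP : is_transition_matrix P.

Lemma trans_ge0 i j : 0 <= P i j.
Proof. by have [h _] := hP i. Qed.

Lemma trans_sum1 i : \sum_j P i j = 1.
Proof. by have [_ h] := hP i. Qed.

Lemma trans_eq0 i j : ~~ edge P i j -> P i j = 0.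
Proof.
rewrite /edge lt0r trans_ge0 andbT negbK; exact: eqP.
Qed.

Lemma stepopD f g i : stepop P (fun k => f k + g k) i = stepop P f i + stepop P g i.
Proof. by rewrite -big_split; apply: eq_bigr => j _; rewrite mulrDr. Qed.

Lemma stepopZ a f i : stepop P (fun k => a * f k) i = a * stepop P f i.
Proof. by rewrite /stepop mulr_sumr; apply: eq_bigr => j _; rewrite mulrCA. Qed.

Lemma stepop_cst a i : stepop P (fun=> a) i = a.
Proof. by rewrite /stepop -mulr_suml trans_sum1 mul1r. Qed.

Lemma nstep_ge0 n i j : 0 <= nstep P n i j.
Proof.
elim: n i => [|n IHn] i /=; first exact: ler0n.
by apply: sumr_ge0 => k _; rewrite mulr_ge0 ?trans_ge0.
Qed.

Lemma irreducible_connect : irreducible P -> forall i j, connect (edge P) i j.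
Proof.
move=> irr i j; have [n] := irr i j; elim: n i => [|n IHn] i /=.
  by case: eqP => [->|_]; rewrite ?connect0 // ltxx.
move=> /lt0r_neq0/eqP h.
have [k /andP[_ hk]] : exists k, true && (P i k * nstep P n k j != 0).
  apply/existsP; apply: contra_notT h => /existsPn h.
  by apply: big1 => k _; apply/eqP; move: (h k); rewrite negbK.
move: hk; rewrite mulf_eq0 negb_or => /andP[hP0 hn0].
apply: (@connect_trans _ _ k).
  by apply: connect1; rewrite /edge lt0r hP0 trans_ge0.
by apply: IHn; rewrite lt0r hn0 nstep_ge0.
Qed.

Hypothesis conP : forall i j, connect (edge P) i j.

(** At a maximiser other than [j] the nonnegative gaps to the maximum average to 0, so every
    successor is a maximiser too; follow a path from a maximiser to [j]. *)
Lemma subharmonic_max (h : I -> R) j :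
  (forall i, i != j -> h i <= stepop P h i) -> forall i, h i <= h j.
Proof.
move=> hsub i.
case: (@arg_maxP _ R I j xpredT h isT) => m _ hmax.
have hm k : h k <= h m by exact: hmax.
suff -> : h j = h m by exact: hm.
have /connectP[s ps ej] := conP m j.
suff along x : h x = h m -> path (edge P) x s -> j = last x s -> h j = h m.
  exact: (along m).
elim: s x {ps ej} => [|y s IHs] x hx /=.
  by move=> _ ->.
move=> /andP[exy ps] ej.
have [-> //|nxj] := eqVneq j x.
apply: (IHs y) => //.
have hs : \sum_k P x k * (h m - h k) = 0.
  apply/eqP; rewrite eq_le sumr_ge0 ?andbT; last first.
    by move=> k _; rewrite mulr_ge0 ?trans_ge0 // subr_ge0 hm.
  have -> : \sum_k P x k * (h m - h k) = h m - stepop P h x.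
    under eq_bigr do rewrite mulrBr.
    by rewrite sumrB -mulr_suml trans_sum1 mul1r.
  by rewrite -hx subr_le0 hsub // eq_sym.
have nn k : xpredT k -> 0 <= P x k * (h m - h k).
  by move=> _; rewrite mulr_ge0 ?trans_ge0 // subr_ge0 hm.
have /eqP := psumr_eq0P nn hs (isT : xpredT y).
by rewrite mulf_eq0 subr_eq0 (gt_eqF exy) /= => /eqP.
Qed.

Lemma superharmonic_min (h : I -> R) j :
  (forall i, i != j -> stepop P h i <= h i) -> forall i, h j <= h i.
Proof.
move=> hsup i.
suff : -1 * h i <= -1 * h j by rewrite !mulN1r lerN2.
apply: (@subharmonic_max (fun k => -1 * h k)) => k nkj.
by rewrite stepopZ !mulN1r lerN2 hsup.
Qed.

Lemma harmonic_cst (h : I -> R) :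
  (forall i, stepop P h i = h i) -> forall i j, h i = h j.
Proof.
by move=> hh i j; apply/eqP; rewrite eq_le !subharmonic_max // => k _; rewrite hh.
Qed.

Variable p : I -> R.
Hypothesis invP : invariant_distribution p P.

Lemma inv_sum1 : \sum_i p i = 1. Proof. by case: invP => -[]. Qed.

Lemma inv_stepop h : \sum_i p i * stepop P h i = \sum_i p i * h i.
Proof.
under eq_bigr do rewrite mulr_sumr.
rewrite exchange_big; apply: eq_bigr => j _ /=.
by under eq_bigr do rewrite mulrA; rewrite -mulr_suml invP.2.
Qed.

Lemma inv_gt0 i : 0 < p i.
Proof.
have [[p0 p1] pinv] := invP.
have [k pk] : exists k, 0 < p k.
  apply/not_existsP => h; have := p1; rewrite big1 => [/eqP|k _].
    by rewrite eq_sym oner_eq0.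
  by apply/eqP; rewrite eq_le p0 andbT leNgt; apply/negP/h.
have /connectP[s] := conP k i.
elim: s k pk => [|y s IHs] k pk /=; first by move=> _ ->.
move=> /andP[eky ps] ei; apply: (IHs y) => //.
rewrite -pinv (bigD1 k) //= ltr_pwDl ?mulr_gt0 //.
by apply: sumr_ge0 => j _; rewrite mulr_ge0 ?trans_ge0.
Qed.

(** The operator [T] is I - P + Π. It is injective since harmonic functions are constant, hence onto
    in finite dimension. Integrating against [p] shows that a preimage of a centred function has
    mean 0, so the rank-one term drops out. *)
Lemma poisson_solution (f : I -> R) :
  \sum_i p i * f i = 0 -> exists g, forall i, g i - stepop P g i = f i.
Proof.
move=> pf.
pose T (u : {ffun I -> R^o}) : {ffun I -> R^o} :=
  [ffun i => u i - stepop P u i + \sum_j p j * u j].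
have Tlin : linear T.
  move=> a u v; apply/ffunP => i; rewrite !ffunE /=.
  have E1 : stepop P (a *: u + v) i = a * stepop P u i + stepop P v i.
    rewrite -stepopZ -stepopD; apply: eq_bigr => k _; congr (_ * _).
    by rewrite !ffunE.
  have E2 : \sum_j p j * (a *: u + v) j =
            a * (\sum_j p j * u j) + \sum_j p j * v j.
    rewrite mulr_sumr -big_split; apply: eq_bigr => k _ /=.
    by rewrite !ffunE mulrDr mulrCA.
  by rewrite E1 E2 /GRing.scale /=; ring.
have pT u : \sum_i p i * T u i = \sum_j p j * u j.
  under eq_bigr do rewrite ffunE mulrDr mulrBr.
  by rewrite big_split sumrB /= inv_stepop subrr add0r -mulr_suml inv_sum1 mul1r.
pose HT := GRing.isLinear.Build _ _ _ _ T Tlin.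
pose TL : {linear {ffun I -> R^o} -> {ffun I -> R^o}} := HB.pack T HT.
have TE u : linfun TL u = T u by rewrite lfunE.
have ker0 : lker (linfun TL) == 0%VS.
  apply/lker0P => u v; rewrite !TE => Tuv.
  have puv : \sum_j p j * u j = \sum_j p j * v j by rewrite -(pT u) -(pT v) Tuv.
  have huv i : stepop P (fun k => u k + -1 * v k) i = u i + -1 * v i.
    have /ffunP/(_ i) := Tuv; rewrite !ffunE puv stepopD stepopZ => H; lra.
  have cuv := @harmonic_cst _ huv.
  apply/ffunP => i.
  have : \sum_j p j * (u j + -1 * v j) = 0.
    under eq_bigr do rewrite mulrDr mulN1r mulrN.
    by rewrite sumrB puv subrr.
  under eq_bigr => j _ do rewrite (cuv j i).
  by rewrite -mulr_suml inv_sum1 => H; lra.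
have : [ffun i => f i : R^o] \in limg (linfun TL) by rewrite lker0_limgf ?memvf.
case/memv_imgP => u _; rewrite TE => Tu; exists u => i.
have pu : \sum_j p j * u j = 0.
  by rewrite -(pT u) -[RHS]pf; apply: eq_bigr => j _; rewrite -Tu ffunE.
by have /ffunP/(_ i) := Tu; rewrite !ffunE pu addr0.
Qed.

End TransitionMatrix.

(** * Path expectations and the martingale of a Poisson solution *)

Section PathSums.
Set Implicit Arguments.
Unset Strict Implicit.
Variables (R : realType) (I : finType) (P : I -> I -> R).
Hypothesis hP : is_transition_matrix P.

(** Conditional expectation of F(X_1, ..., X_n) given X_0 = x; the starting point is not in the list
    passed to [F]. *)
Definition path_exp (n : nat) (x : I) (F : seq I -> R) : R :=
  \sum_(t : n.-tuple I) transition_prob P x t * F t.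

Lemma sum_tuple_cons n (F : seq I -> R) :
  \sum_(t : n.+1.-tuple I) F t = \sum_x \sum_(t : n.-tuple I) F (x :: t).
Proof.
rewrite pair_bigA /= (reindex (fun u : I * n.-tuple I => [tuple of u.1 :: u.2])) //=.
exists (fun t => (thead t, [tuple of behead t])) => [[x t] _|t _] /=.
  by congr (_, _); apply: val_inj.
by rewrite [RHS]tuple_eta; apply: val_inj.
Qed.

Lemma path_exp0 x F : path_exp 0 x F = F [::].
Proof.
rewrite /path_exp (eq_bigr (fun=> F [::])) => [|t _]; last by rewrite tuple0 mul1r.
by rewrite sumr_const card_tuple expn0.
Qed.

Lemma path_expS n x F :
  path_exp n.+1 x F = stepop P (fun y => path_exp n y (fun s => F (y :: s))) x.
Proof.
rewrite /path_exp (sum_tuple_cons n (fun s => transition_prob P x s * F s)).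
apply: eq_bigr => y _; rewrite mulr_sumr; apply: eq_bigr => t _ /=.
by rewrite mulrA.
Qed.

Lemma transition_prob_ge0 x s : 0 <= transition_prob P x s.
Proof. by elim: s x => //= y s IHs x; rewrite mulr_ge0 ?trans_ge0. Qed.

Lemma path_expD n x F G :
  path_exp n x (fun s => F s + G s) = path_exp n x F + path_exp n x G.
Proof. by rewrite -big_split; apply: eq_bigr => t _; rewrite mulrDr. Qed.

Lemma path_expZ n x a F : path_exp n x (fun s => a * F s) = a * path_exp n x F.
Proof. by rewrite mulr_sumr; apply: eq_bigr => t _; rewrite mulrCA. Qed.

Lemma path_exp_le n x F G :
  (forall s, F s <= G s) -> path_exp n x F <= path_exp n x G.
Proof. by move=> FG; apply: ler_sum => t _; rewrite ler_wpM2l ?transition_prob_ge0. Qed.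

Lemma path_exp_cst n x a : path_exp n x (fun=> a) = a.
Proof.
elim: n x => [|n IHn] x; first by rewrite path_exp0.
by rewrite path_expS /stepop; under eq_bigr do rewrite IHn; exact: stepop_cst.
Qed.

(** The martingale with increments g(X_{k+1}) - (P g)(X_k), along the path [x :: s]. *)
Fixpoint mart (g : I -> R) (x : I) (s : seq I) : R :=
  if s is y :: s' then g y - stepop P g x + mart g y s' else 0.

(** Regrouping into increments leaves two boundary terms, bounded independently of the length. *)
Lemma sum_poisson g x s :
  \sum_(y <- x :: s) (g y - stepop P g y) =
  g x + mart g x s - stepop P g (last x s).
Proof.
elim: s x => [|y s IHs] x; first by rewrite big_seq1 addr0.
by rewrite big_cons IHs /=; ring.
Qed.

Lemma path_exp_mart g n x : path_exp n x (mart g x) = 0.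
Proof.
elim: n x => [|n IHn] x; first by rewrite path_exp0.
rewrite path_expS /stepop.
under eq_bigr => y _ do rewrite /= path_expD IHn path_exp_cst addr0 mulrBr.
by rewrite sumrB -mulr_suml trans_sum1 // mul1r subrr.
Qed.

Definition step_variance (g : I -> R) (x : I) : R :=
  stepop P (fun y => g y ^+ 2) x - stepop P g x ^+ 2.

(** Given the first step [y], the first increment is a constant and the later martingale has mean 0,
    so the cross term vanishes. *)
Lemma path_exp_mart2S g n x :
  path_exp n.+1 x (fun s => mart g x s ^+ 2) =
  step_variance g x + stepop P (fun y => path_exp n y (fun s => mart g y s ^+ 2)) x.
Proof.
have E y : path_exp n y (fun s => mart g x (y :: s) ^+ 2) =
    (g y ^+ 2 - 2 * stepop P g x * g y + stepop P g x ^+ 2) +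
    path_exp n y (fun s => mart g y s ^+ 2).
  set d := g y - stepop P g x.
  rewrite (_ : (fun s => _) =
    fun s => (d ^+ 2 + 2 * d * mart g y s) + mart g y s ^+ 2); last first.
    by apply/funext => s /=; rewrite -/d; ring.
  rewrite !path_expD path_expZ path_exp_mart path_exp_cst /d; ring.
rewrite path_expS /stepop.
under eq_bigr => y _ do rewrite E mulrDr.
rewrite big_split /=; congr (_ + _).
under eq_bigr => y _ do rewrite mulrDr mulrBr [P x y * (2 * _ * _)]mulrCA.
rewrite big_split sumrB /= -mulr_sumr -mulr_suml trans_sum1 //.
by rewrite /step_variance /stepop; ring.
Qed.

Hypothesis conP : forall i j, connect (edge P) i j.
Variable p : I -> R.
Hypothesis invP : invariant_distribution p P.

Lemma fun_bounded (u : I -> R) : exists2 K, 0 <= K & forall i, `|u i| <= K.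
Proof.
exists (\sum_i `|u i|); first exact: sumr_ge0.
by move=> i; rewrite (bigD1 i) //= lerDl sumr_ge0.
Qed.

(* With [u] solving the Poisson equation of the centred step variance, the
   deviation of the second moment minus [u] is propagated by [P], so it never
   exceeds its initial size. *)
Lemma path_exp_mart2_bound g : exists2 C, 0 <= C & forall n x,
  `|path_exp n x (fun s => mart g x s ^+ 2) -
    n%:R * \sum_i p i * step_variance g i| <= C.
Proof.
set c := \sum_i _.
have [u hu] : exists u, forall i, u i - stepop P u i = step_variance g i - c.
  apply: (poisson_solution hP conP invP).
  under eq_bigr do rewrite mulrBr.
  by rewrite sumrB -mulr_suml (inv_sum1 invP) mul1r subrr.
have [K K0 hK] := fun_bounded u.
exists (2 * K) => [|n x]; first by rewrite mulr_ge0.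
suff H : `|path_exp n x (fun s => mart g x s ^+ 2) - n%:R * c - u x| <= K.
  have := ler_normD (path_exp n x (fun s => mart g x s ^+ 2) - n%:R * c - u x) (u x).
  rewrite subrK => /le_trans -> //; have := hK x; lra.
elim: n x => [|n IHn] x.
  by rewrite path_exp0 /= expr0n /= mul0r subrr sub0r normrN.
have -> : path_exp n.+1 x (fun s => mart g x s ^+ 2) - n.+1%:R * c - u x =
    stepop P (fun y => path_exp n y (fun s => mart g y s ^+ 2) - n%:R * c - u y) x.
  rewrite path_exp_mart2S.
  have -> : (fun y => path_exp n y (fun s => mart g y s ^+ 2) - n%:R * c - u y) =
    (fun y => path_exp n y (fun s => mart g y s ^+ 2) + (- (n%:R * c) + -1 * u y)).
    by apply/funext => y; ring.
  rewrite !stepopD stepopZ stepop_cst // -natr1; have := hu x; lra.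
apply: le_trans (ler_norm_sum _ _ _) _.
rewrite -[leRHS](stepop_cst hP K x); apply: ler_sum => y _.
by rewrite normrM ger0_norm ?trans_ge0 // ler_wpM2l ?trans_ge0.
Qed.

End PathSums.

(** * Asymptotic variance through the Poisson equation *)

Section AsymptoticVariance.
Set Implicit Arguments.
Unset Strict Implicit.
Variables (R : realType) (I : finType) (P : I -> I -> R) (p : I -> R).
Hypothesis hP : is_transition_matrix P.
Hypothesis conP : forall i j, connect (edge P) i j.
Hypothesis invP : invariant_distribution p P.

(** By invariance P(g^2) and g^2 have the same mean, and g^2 - (P g)^2 = 2 (g - P g) g - (g - P
    g)^2. *)
Lemma sum_step_variance g :
  \sum_i p i * step_variance P g i =
  2 * (\sum_i p i * ((g i - stepop P g i) * g i)) -
  \sum_i p i * (g i - stepop P g i) ^+ 2.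
Proof.
rewrite /step_variance.
under eq_bigr do rewrite mulrBr.
rewrite sumrB inv_stepop // -sumrB mulr_sumr -sumrB.
by apply: eq_bigr => i _; ring.
Qed.

(** Young's inequality, from the squares of t m - b and t m + b: a bounded perturbation [b] costs an
    arbitrarily small share of m^2 plus a constant. *)
Lemma young_sqr (t B m b : R) : 0 < t -> `|b| <= B ->
  `|(m + b) ^+ 2 - m ^+ 2| <= t * m ^+ 2 + (1 + t^-1) * B ^+ 2.
Proof.
move=> t0 bB.
have bb : b ^+ 2 <= B ^+ 2.
  rewrite -(real_normK (num_real b)) ler_sqr // nnegrE //.
  exact: le_trans bB.
have ti : 0 < t^-1 by rewrite invr_gt0.
have tt : t^-1 * t = 1 by rewrite mulVf ?gt_eqF.
have s1 : 0 <= t^-1 * (t * m - b) ^+ 2 by apply: mulr_ge0; rewrite ?sqr_ge0 // ltW.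
have s2 : 0 <= t^-1 * (t * m + b) ^+ 2 by apply: mulr_ge0; rewrite ?sqr_ge0 // ltW.
have e1 : t^-1 * (t * m - b) ^+ 2 =
    (t^-1 * t) * (t * m ^+ 2 - 2 * m * b) + t^-1 * b ^+ 2.
  by ring.
have e2 : t^-1 * (t * m + b) ^+ 2 =
    (t^-1 * t) * (t * m ^+ 2 + 2 * m * b) + t^-1 * b ^+ 2.
  by ring.
rewrite tt in e1 e2.
have h1 : t^-1 * b ^+ 2 <= t^-1 * B ^+ 2 by rewrite ler_wpM2l // ltW.
have b0 := sqr_ge0 b.
have e3 : (m + b) ^+ 2 - m ^+ 2 = 2 * m * b + b ^+ 2 by ring.
rewrite e3 ler_norml; apply/andP; split; lra.
Qed.

Variable mu : I -> R.
Hypothesis hmu : is_distribution mu.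

Lemma chain_expectationS n (F : seq I -> R) :
  chain_expectation mu P (fun t : n.+1.-tuple I => F t) =
  \sum_x mu x * path_exp P n x (fun s => F (x :: s)).
Proof.
rewrite /chain_expectation (sum_tuple_cons n (fun s => path_prob mu P s * F s)).
apply: eq_bigr => x _; rewrite mulr_sumr; apply: eq_bigr => t _ /=.
by rewrite mulrA.
Qed.

Lemma mean_dist_norm (u : I -> R) C : (forall x, `|u x| <= C) ->
  `|\sum_x mu x * u x| <= C.
Proof.
move=> uC; apply: le_trans (ler_norm_sum _ _ _) _.
rewrite -[leRHS]mul1r -hmu.2 mulr_suml; apply: ler_sum => x _.
by rewrite normrM ger0_norm ?hmu.1 // ler_wpM2l ?hmu.1.
Qed.

(** The sum of the centred [f] is the martingale of [g] up to a bounded term, which is negligible at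
    order n in the second moment; that of the martingale is n c up to a bounded error. *)
Lemma asymptotic_varianceE f g :
  (forall i, g i - stepop P g i = f i - mean p f) ->
  asymptotic_variance mu f P p = \sum_i p i * step_variance P g i.
Proof.
move=> hg; set c := \sum_i _.
have [C C0 hC] := path_exp_mart2_bound hP conP invP g.
have [K K0 hK] := fun_bounded g.
have [L L0 hL] := fun_bounded (stepop P g).
have bnd t n : 0 < t ->
    `|(\sum_x mu x * path_exp P n x (fun s =>
        (\sum_(y <- x :: s) (f y - mean p f)) ^+ 2)) - n%:R * c| <=
    C + (t * (n%:R * c + C) + (1 + t^-1) * (K + L) ^+ 2).
  move=> t0.
  under eq_bigr do rewrite -[X in _ * X](subrK (n%:R * c)) mulrDr.
  rewrite big_split /= -[X in _ + X - _]mulr_suml hmu.2 mul1r addrK.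
  apply: mean_dist_norm => x.
  set S := path_exp _ _ _ _; set M := path_exp P n x (fun s => mart P g x s ^+ 2).
  have MC : `|M - n%:R * c| <= C by exact: hC.
  have D s : `|(\sum_(y <- x :: s) (f y - mean p f)) ^+ 2 - mart P g x s ^+ 2|
      <= t * mart P g x s ^+ 2 + (1 + t^-1) * (K + L) ^+ 2.
    under eq_bigr do rewrite -hg.
    rewrite sum_poisson (_ : g x + _ - _ =
      mart P g x s + (g x - stepop P g (last x s))); last by ring.
    apply: young_sqr => //; apply: le_trans (ler_normB _ _) _.
    exact: lerD.
  have SM : `|S - M| <= t * M + (1 + t^-1) * (K + L) ^+ 2.
    have -> : t * M + (1 + t^-1) * (K + L) ^+ 2 = path_exp P n x
        (fun s => t * mart P g x s ^+ 2 + (1 + t^-1) * (K + L) ^+ 2).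
      by rewrite path_expD path_expZ path_exp_cst.
    rewrite ler_norml lerBrDr addrC lerBlDr lerBlDr -!path_expD.
    by apply/andP; split; apply: path_exp_le => // s;
      have := D s; rewrite ler_norml => /andP[]; lra.
  have tM : t * M <= t * (n%:R * c + C).
    rewrite ler_wpM2l // ?(ltW t0) //; move: MC; rewrite ler_norml => /andP[]; lra.
  rewrite (_ : S - _ = (M - n%:R * c) + (S - M)); last by ring.
  apply: le_trans (ler_normD _ _) _; lra.
rewrite /asymptotic_variance; apply/cvg_lim => //.
(* The shift makes paths nonempty; n + 1 states carry n martingale increments. *)
rewrite -cvg_shiftS /=.
apply/cvgrPdist_le => e e0 /=.
(* [t] keeps the error term growing with n below e / 2 per step; [D] collects the bounded terms,
   with |c| for the gap between n + 1 and n. *)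
pose t := e / (2 * (`|c| + 1)).
have c1 : 0 < `|c| + 1 by rewrite ltr_wpDl.
have t0 : 0 < t by rewrite divr_gt0 ?mulr_gt0.
pose D := C + (t * C + (1 + t^-1) * (K + L) ^+ 2) + `|c|.
have tc : t * `|c| <= e / 2.
  have -> : e / 2 = t * (`|c| + 1) by rewrite /t; field; rewrite gt_eqF.
  by rewrite ler_wpM2l ?(ltW t0) // lerDl.
near=> n.
have n0 : 0 < n.+1%:R :> R by rewrite ltr0n.
have nD : D <= e / 2 * n.+1%:R.
  rewrite -ler_pdivrMl ?divr_gt0 //.
  apply: (@le_trans _ _ n%:R); last by rewrite ler_nat.
  near: n; exact: nbhs_infty_ger.
have -> : chain_expectation mu P (fun s : n.+1.-tuple I =>
    (n.+1%:R^-1 * (\sum_(k < n.+1) f (tnth s k)) - mean p f) ^+ 2) =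
  n.+1%:R^-1 ^+ 2 * \sum_x mu x * path_exp P n x (fun s =>
        (\sum_(y <- x :: s) (f y - mean p f)) ^+ 2).
  rewrite mulr_sumr; under [RHS]eq_bigr do rewrite mulrCA -path_expZ.
  rewrite -(chain_expectationS n (fun s => n.+1%:R^-1 ^+ 2 *
     (\sum_(y <- s) (f y - mean p f)) ^+ 2)).
  apply: eq_bigr => s _; congr (_ * _).
  rewrite -exprMn; congr (_ ^+ 2).
  rewrite big_tuple sumrB sumr_const card_ord mulrBr; congr (_ - _).
  by rewrite -[mean p f *+ _]mulr_natl mulKf // pnatr_eq0.
set E := \sum_x _.
have hE : `|E - n%:R * c| <= C + (t * (n%:R * c + C) + (1 + t^-1) * (K + L) ^+ 2).
  exact: bnd.
have -> : c - n.+1%:R * (n.+1%:R^-1 ^+ 2 * E) = n.+1%:R^-1 * (n.+1%:R * c - E).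
  by rewrite mulrBr mulKf ?gt_eqF // expr2 -mulrA mulVKf ?gt_eqF.
rewrite normrM ger0_norm ?invr_ge0 ?ler0n // ler_pdivrMl //.
have -> : n.+1%:R * c - E = c - (E - n%:R * c) by rewrite -natr1; ring.
apply: le_trans (ler_normB _ _) _.
have tnc : t * (n%:R * c) <= e / 2 * n.+1%:R.
  apply: (@le_trans _ _ (n%:R * (t * `|c|))).
    rewrite [t * _]mulrCA ler_wpM2l ?ler0n // ler_wpM2l ?(ltW t0) //.
    exact: ler_norm.
  rewrite [leRHS]mulrC; apply: ler_pM => //; first by rewrite mulr_ge0 ?(ltW t0).
  by rewrite ler_nat.
move: nD; rewrite /D; lra.
Unshelve. all: by end_near.
Qed.

End AsymptoticVariance.

(** * Branches of an acyclic graph *)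

Section Branches.
Set Implicit Arguments.
Unset Strict Implicit.
Variables (I : finType) (e : rel I).
Hypothesis e_acy : acyclic e.

Definition avoid (i : I) : rel I := [rel x y | [&& e x y, x != i & y != i]].

(** The part reachable from [j] once the vertex [i] is deleted: for an edge i - j of a forest, the
    side of [j]. *)
Definition branch (i j : I) : {set I} := [set k | connect (avoid i) j k].

Lemma path_avoid i x s : path e x s -> i \notin x :: s -> path (avoid i) x s.
Proof.
elim: s x => //= y s IHs x /andP[exy ps].
rewrite inE negb_or => /andP[nix nis].
rewrite /avoid /= exy IHs // andbT eq_sym nix.
by move: nis; rewrite inE negb_or eq_sym => /andP[].
Qed.

Lemma avoid_path i x s : x != i -> path (avoid i) x s -> path e x s && (i \notin x :: s).
Proof.
elim: s x => [|y s IHs] x nxi /=; first by rewrite inE eq_sym.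
move=> /andP[/and3P[-> _ nyi] /(IHs _ nyi)/andP[-> nis]].
by rewrite inE negb_or eq_sym nxi.
Qed.

Lemma branch_id i j : j \in branch i j.
Proof. by rewrite inE connect0. Qed.

Lemma branch_root i j : j != i -> i \notin branch i j.
Proof.
move=> nji; rewrite inE; apply/negP => /connectP[s ps es].
have /andP[_ /negP[]] := avoid_path nji ps.
by rewrite es mem_last.
Qed.

Lemma branch_step i j k l :
  j != i -> k \in branch i j -> e k l -> l != i -> l \in branch i j.
Proof.
move=> nji kb ekl nli; have := kb; rewrite !inE => /connect_trans; apply.
apply: connect1; rewrite /avoid /= ekl nli andbT.
by apply: contraNneq (branch_root nji) => ki; rewrite ki in kb.
Qed.

(** An exit must lead to [i]. If it started elsewhere than at [j], a simple path from [j] to its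
    start would close up through [i] into a cycle of at least three vertices. *)
Lemma branch_cut i j k l : e i j -> j != i -> k \in branch i j ->
  l \notin branch i j -> e k l -> k = j /\ l = i.
Proof.
move=> eij nji kb lb ekl.
have li : l = i by apply: contraNeq lb; exact: (branch_step nji kb ekl).
split=> //; subst l.
move: kb; rewrite inE => /connectP[s ps ek].
move: ekl; rewrite {k}ek; case/shortenP: ps => t pt ut _.
case: t pt ut => [//|y t] pt ut ekl.
have /andP[pe ni] := avoid_path nji pt.
case: (@e_acy [:: i, j, y & t] isT).
rewrite /ucycle /= -/(cat _ _) in pe ut *.
move: pe => /andP[-> pe].
by rewrite eij rcons_path pe ekl /= ni.
Qed.

Lemma branch_split i j k : k \in branch i j -> k != j ->
  exists c, [/\ e j c, c != j, c != i & k \in branch j c].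
Proof.
rewrite inE => /connectP[s ps ->].
case/shortenP: ps => -[|c t] /= pt ut _; first by rewrite eqxx.
move: pt ut => /andP[/and3P[ejc nji nci] pt] /andP[njt ut] _.
have /andP[pe _] := avoid_path nci pt.
exists c; split=> //.
  by apply: contraNneq njt => ->; rewrite mem_head.
by rewrite inE; apply/connectP; exists t => //; exact: path_avoid.
Qed.

(** If [i] lay in [branch j c], the edge from [i] to [j] would leave that branch, forcing i = c. So
    walks from [c] avoiding [j] never meet [i]; the vertex [j] makes the inclusion strict. *)
Lemma branch_proper i j c : e i j -> j != i -> e j c -> c != j -> c != i ->
  branch j c \proper branch i j.
Proof.
move=> eij nji ejc ncj nci; apply/properP; split; last first.
  by exists j; rewrite ?branch_id ?branch_root.
have nib : i \notin branch j c.
  apply/negP => ib.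
  have [ic _] := branch_cut ejc ncj ib (branch_root ncj) eij.
  by rewrite ic eqxx in nci.
apply/fintype.subsetP => m; rewrite inE => /connectP[s ps ->].
suff along x : x \in branch j c -> x \in branch i j ->
    path (avoid j) x s -> last x s \in branch i j.
  apply: along ps; first exact: branch_id.
  exact: (branch_step nji (branch_id i j) ejc nci).
elim: s {ps} x => //= y s IHs x xc xi /andP[/and3P[exy _ nyj] ps].
have yc : y \in branch j c by exact: (branch_step ncj xc exy nyj).
apply: IHs => //; apply: (branch_step nji xi exy).
by apply: contraNneq nib => <-.
Qed.

End Branches.

(** * Weighted inner product, the Laplacian I - P and time reversal *)

Section Reversal.
Set Implicit Arguments.
Unset Strict Implicit.
Variables (R : realType) (I : finType) (p : I -> R).

Definition inner (f g : I -> R) : R := \sum_i p i * (f i * g i).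

Definition lap (P : I -> I -> R) (h : I -> R) (i : I) : R := h i - stepop P h i.

(** The stationary chain run backwards, which is the adjoint of [P] in L^2(p). *)
Definition reversal (P : I -> I -> R) (i j : I) : R := p j * P j i / p i.

Lemma innerC f g : inner f g = inner g f.
Proof. by apply: eq_bigr => i _; rewrite [f i * _]mulrC. Qed.

Lemma innerDl f g h : inner (fun k => f k + g k) h = inner f h + inner g h.
Proof. by rewrite -big_split; apply: eq_bigr => k _ /=; ring. Qed.

Lemma innerZl a f h : inner (fun k => a * f k) h = a * inner f h.
Proof. by rewrite mulr_sumr; apply: eq_bigr => k _ /=; ring. Qed.

Lemma inner_expand f u v w t :
  inner (fun k => f k + t * u k) (fun k => v k + t * w k) =
  inner f v + t * (inner f w + inner u v) + t ^+ 2 * inner u w.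
Proof.
rewrite /inner -big_split !mulr_sumr -!big_split /=.
by apply: eq_bigr => k _; ring.
Qed.

Lemma lapD P f g i : lap P (fun k => f k + g k) i = lap P f i + lap P g i.
Proof. by rewrite /lap stepopD; ring. Qed.

Lemma lapZ P a f i : lap P (fun k => a * f k) i = a * lap P f i.
Proof. by rewrite /lap stepopZ; ring. Qed.

Hypothesis p_gt0 : forall i, 0 < p i.

Lemma lap_adjoint P f g : inner (lap (reversal P) f) g = inner f (lap P g).
Proof.
rewrite /inner /lap.
under eq_bigr do rewrite mulrBl mulrBr.
under [RHS]eq_bigr do rewrite mulrBr mulrBr.
rewrite !sumrB; congr (_ - _).
under eq_bigr => i _ do rewrite /stepop mulr_suml mulr_sumr.
under [RHS]eq_bigr => i _ do rewrite /stepop !mulr_sumr.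
rewrite exchange_big; apply: eq_bigr => i _; apply: eq_bigr => j _ /=.
by rewrite /reversal; field; rewrite gt_eqF.
Qed.

Lemma reversible_reversal P : reversible p P -> reversal P = P.
Proof.
move=> rev; apply/funext => i; apply/funext => j.
by rewrite /reversal -rev mulrAC mulfV ?mul1r // gt_eqF.
Qed.

Variable P : I -> I -> R.
Hypothesis hP : is_transition_matrix P.
Hypothesis conP : forall i j, connect (edge P) i j.
Hypothesis invP : invariant_distribution p P.

Lemma reversal_transition : is_transition_matrix (reversal P).
Proof.
move=> i; split=> [j|].
  by rewrite divr_ge0 ?mulr_ge0 ?(ltW (p_gt0 _)) ?trans_ge0.
by rewrite /reversal -mulr_suml invP.2 mulfV // gt_eqF.
Qed.

Lemma reversal_invariant : invariant_distribution p (reversal P).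
Proof.
split=> [|j]; first exact: invP.1.
rewrite /reversal; under eq_bigr => i _ do rewrite mulrC divfK ?gt_eqF //.
by rewrite -mulr_sumr trans_sum1 ?mulr1.
Qed.

Lemma reversal_connect i j : connect (edge (reversal P)) i j.
Proof.
rewrite (@eq_connect _ _ [rel x y | edge P y x]) ?connect_rev //= ?conP //.
move=> x y; rewrite /edge /reversal /= pmulr_lgt0 ?invr_gt0 //.
by rewrite pmulr_rgt0.
Qed.

End Reversal.

(** * Comparison of [P] and [P']: first variation and induction over branches *)

Section Comparison.
Set Implicit Arguments.
Unset Strict Implicit.
Variables (R : realType) (I : finType) (p : I -> R) (P P' : I -> I -> R).
Hypothesis hP : is_transition_matrix P.
Hypothesis conP : forall i j, connect (edge P) i j.
Hypothesis revP : reversible p P.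
Hypothesis invP : invariant_distribution p P.
Hypothesis hP' : is_transition_matrix P'.
Hypothesis conP' : forall i j, connect (edge P') i j.
Hypothesis invP' : invariant_distribution p P'.
Hypothesis dom : forall g v, (forall i, lap P' v i = lap P g i) ->
  inner p (lap P g) v <= inner p (lap P g) g.

Let p_gt0 := inv_gt0 hP conP invP.

Lemma lap_selfadjoint f g : inner p (lap P f) g = inner p f (lap P g).
Proof. by rewrite -[in LHS](reversible_reversal p_gt0 revP) lap_adjoint. Qed.

Lemma lap_mean0 g : \sum_i p i * lap P g i = 0.
Proof.
by under eq_bigr do rewrite mulrBr; rewrite sumrB inv_stepop // subrr.
Qed.

Lemma linear_term_eq0 (a b : R) : (forall t, t * a + t ^+ 2 * b <= 0) -> a = 0.
Proof.
move=> h; have b1 : 0 < `|b| + 1 by rewrite ltr_wpDl.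
(* For this t, t a = t^2 (|b| + 1), and |b| + 1 + b is positive. *)
have := h (a / (`|b| + 1)).
have -> : a / (`|b| + 1) * a + (a / (`|b| + 1)) ^+ 2 * b =
    (a / (`|b| + 1)) ^+ 2 * (`|b| + 1 + b).
  by field; rewrite gt_eqF.
rewrite pmulr_lle0; last by have := ler_norm (- b); rewrite normrN; lra.
move=> h2; have : (a / (`|b| + 1)) ^+ 2 == 0 by rewrite eq_le h2 sqr_ge0.
by rewrite expf_eq0 /= mulf_eq0 invr_eq0 (gt_eqF b1) orbF => /eqP.
Qed.

(* Equality in [dom] at [lap P g] makes [g] a critical point of the difference
   of the two quadratic forms. *)
Lemma first_variation g v vs :
  (forall i, lap P' v i = lap P g i) ->
  (forall i, lap (reversal p P') vs i = lap P g i) ->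
  inner p (lap P g) g <= inner p (lap P g) v ->
  forall i j, v i + vs i - 2 * g i = v j + vs j - 2 * g j.
Proof.
move=> hv hvs ge i j.
pose z k := v k + (vs k + -2 * g k).
suff zc : z i = z j by move: zc; rewrite /z; lra.
apply: (harmonic_cst hP conP) => k.
suff : lap P z k = 0 by rewrite /lap => /eqP; rewrite subr_eq0 => /eqP.
(* Perturb [g] by t x in [dom]: the two sides agree at t = 0, and the coefficient of t in their
   difference is the inner product of [z] and [lap P x]. *)
have orth x : inner p z (lap P x) = 0.
  have [w hw] := poisson_solution hP' conP' invP' (lap_mean0 x).
  pose f := lap P g; pose u := lap P x.
  apply: (@linear_term_eq0 _ (inner p u w - inner p u x)) => t.
  have /dom : forall k, lap P' (fun k => v k + t * w k) k =
      lap P (fun k => g k + t * x k) k.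
    by move=> l; rewrite !lapD !lapZ hv; congr (_ + t * _); exact: hw.
  rewrite (_ : lap P (fun k => _) = fun k => f k + t * u k); last first.
    by apply/funext => l; rewrite lapD lapZ.
  rewrite (inner_expand p f u v w) (inner_expand p f u g x).
  have e1 : inner p f w = inner p vs u.
    rewrite /f -(_ : lap (reversal p P') vs = lap P g); last exact/funext.
    rewrite lap_adjoint //; congr (inner p _ _); exact/funext.
  have e2 : inner p f x = inner p g u by rewrite lap_selfadjoint.
  have e3 : inner p u v = inner p v u by rewrite innerC.
  have e4 : inner p u g = inner p g u by rewrite innerC.
  have -> : inner p z (lap P x) = inner p v u + (inner p vs u + -2 * inner p g u).
    by rewrite /z innerDl innerDl innerZl.
  rewrite e1 e2 e3 e4; move: ge; rewrite -/f; lra.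
(* Self-adjointness turns this instance into the squared norm of [lap P z]. *)
have /eqP := orth (lap P z); rewrite -lap_selfadjoint /inner psumr_eq0 => [|l _].
  move=> /allP/(_ k (mem_index_enum _)) /=.
  by rewrite mulf_eq0 (gt_eqF (p_gt0 _)) /= mulf_eq0 orbb => /eqP.
by rewrite mulr_ge0 ?(ltW (p_gt0 _)) // -expr2 sqr_ge0.
Qed.

Definition agree (k : I) : Prop := forall l, P' k l = P k l /\ P' l k = P l k.

Lemma edge_symmetric : symmetric (edge P).
Proof.
by move=> i j; rewrite /edge -(pmulr_rgt0 _ (p_gt0 i)) revP pmulr_rgt0.
Qed.

(** Of a branch only the cut property is kept: [A] is joined to its complement by the single edge j
    - i. *)
Lemma cut_agree (A : {set I}) i j :
  j \in A -> i \notin A -> edge P j i -> P j j = 0 ->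
  (forall k l, k \in A -> l \notin A -> edge P k l -> k = j /\ l = i) ->
  (forall k, k \in A -> k != j -> agree k) -> agree j.
Proof.
move=> jA iA eji Pjj cut agr.
have nij : i != j by apply: contraNneq iA => ->.
have cut0 k l : k \in A -> l \notin A -> (k != j) || (l != i) -> P k l = 0.
  move=> kA lA h; apply: trans_eq0 => //; apply/negP => /(cut _ _ kA lA)[kj li].
  by rewrite kj li !eqxx in h.
pose g k : R := (k \in A)%:R.
pose f := lap P g.
have gE k Q : stepop Q g k = \sum_(l in A) Q k l.
  rewrite /stepop [RHS]big_mkcond; apply: eq_bigr => l _ /=.
  by rewrite /g; case: (l \in A); rewrite ?mulr1 ?mulr0.
have fA k : k \in A -> f k = \sum_(l | l \notin A) P k l.
  move=> kA; rewrite /f /lap gE /g kA mulr1n.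
  by rewrite -[X in X - _](trans_sum1 hP k) (bigID (mem A)) /= addrAC subrr add0r.
have fj : f j = P j i.
  rewrite fA // (bigD1 i) //= big1 ?addr0 // => l /andP[lA nli].
  by rewrite cut0 // nli orbT.
have fA0 k : k \in A -> k != j -> f k = 0.
  by move=> kA nkj; rewrite fA // big1 // => l lA; rewrite cut0 // nkj.
have fC k : k \notin A -> f k = - \sum_(l in A) P k l.
  by move=> kA; rewrite /f /lap gE /g (negbTE kA) sub0r.
have sym0 k l : P k l = 0 -> P l k = 0.
  by move=> h; apply: trans_eq0 => //; rewrite edge_symmetric /edge h ltxx.
have fi : f i = - P i j.
  rewrite fC // (bigD1 j) //= big1 ?addr0 // => l /andP[lA nlj].
  by apply: sym0; rewrite cut0 // nlj.
have fC0 k : k \notin A -> k != i -> f k = 0.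
  move=> kA nki; rewrite fC // big1 ?oppr0 // => l lA.
  by apply: sym0; rewrite cut0 // nki orbT.
have f0 k : k != j -> k != i -> f k = 0.
  by move=> nkj nki; have [kA|kA] := boolP (k \in A); [apply: fA0|apply: fC0].
have f_le0 k : k != j -> f k <= 0.
  move=> nkj; have [->|nki] := eqVneq k i; last by rewrite f0.
  by rewrite fi oppr_le0 trans_ge0.
have f_ge0 k : k != i -> 0 <= f k.
  move=> nki; have [->|nkj] := eqVneq k j; last by rewrite f0.
  by rewrite fj trans_ge0.
have fmean : \sum_k p k * f k = 0 by exact: lap_mean0.
have [v hv] := poisson_solution hP' conP' invP' fmean.
have hP's := reversal_transition p_gt0 hP' invP'.
have conP's := reversal_connect p_gt0 conP'.
have invP's := reversal_invariant p_gt0 hP' invP'.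
have [vs hvs] := poisson_solution hP's conP's invP's fmean.
(* [f] can be negative only at [i] and positive only at [j], so [u] is superharmonic off [i] and
   subharmonic off [j]. *)
have extrema Q u : is_transition_matrix Q ->
    (forall k l, connect (edge Q) k l) -> (forall k, u k - stepop Q u k = f k) ->
    forall k, u i <= u k <= u j.
  move=> hQ conQ hu k; apply/andP; split.
    by apply: (superharmonic_min hQ conQ) => l /f_ge0; rewrite -hu subr_ge0.
  by apply: (subharmonic_max hQ conQ) => l /f_le0; rewrite -hu subr_le0.
have vb := extrema _ _ hP' conP' hv.
have vsb := extrema _ _ hP's conP's hvs.
have innerf u : inner p f u = p j * P j i * (u j - u i).
  rewrite /inner (bigD1 j) //= (bigD1 i) ?nij //= big1 ?addr0 => [|k /andP[nkj nki]].
    by rewrite fj fi mulNr mulrN [p i * _]mulrA -revP; ring.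
  by rewrite f0 // mul0r mulr0.
have w0 : 0 < p j * P j i by rewrite mulr_gt0.
have fg : inner p f g = p j * P j i.
  by rewrite innerf /g jA (negbTE iA) subr0 mulr1.
(* Only row [j] is at issue. Shifted by [v i], [v] is nonnegative and vanishes at [i]; outside the
   entries of [A] known to agree, row [j] of [P] charges only [i]. *)
have lap_ge k : k \in A -> f k <= lap P v k.
  move=> kA; rewrite -hv /lap lerD2l lerN2.
  have [->|nkj] := eqVneq k j; last first.
    by apply: ler_sum => l _; have [-> _] := agr k kA nkj l.
  have split Q : is_transition_matrix Q ->
      stepop Q v j = stepop Q (fun l => v l - v i) j + v i.
    by move=> hQ; rewrite stepopD stepop_cst // subrK.
  rewrite !split // lerD2r; apply: ler_sum => l _.
  have dl : 0 <= v l - v i by rewrite subr_ge0; case/andP: (vb l).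
  have [elj|nlj] := eqVneq l j.
    by rewrite {1}elj Pjj mul0r mulr_ge0 ?trans_ge0.
  have [lA|lA] := boolP (l \in A); first by have [_ ->] := agr l lA nlj j.
  have [->|nli] := eqVneq l i; first by rewrite subrr !mulr0.
  by rewrite cut0 ?nli ?orbT // mul0r mulr_ge0 ?trans_ge0.
(* Self-adjointness moves the Laplacian onto [v], and the indicator [g] keeps only the points of
   [A]. *)
have fv : inner p f g <= inner p f v.
  rewrite {2}/f lap_selfadjoint innerC; apply: ler_sum => k _.
  rewrite ler_wpM2l ?(ltW (p_gt0 k)) // /g.
  by case: (boolP (k \in A)) => kA; rewrite ?mul1r ?mul0r ?lap_ge.
have vji : v j - v i = 1.
  have : inner p f v = inner p f g by apply/le_anti; rewrite fv dom.
  rewrite fg innerf -[RHS]mulr1; apply: mulfI; exact: lt0r_neq0.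
have crit := first_variation hv hvs fv.
have gj : g j = 1 by rewrite /g jA.
have gi : g i = 0 by rewrite /g (negbTE iA).
have vsji : vs j - vs i = 1 by have := crit j i; rewrite gj gi; lra.
(* On [A] the sum v + vs equals its value at [j], where both terms are maximal, so each is maximal;
   off [A] the same holds with minima at [i]. *)
have both k : v k = g k + v i /\ vs k = g k + vs i.
  have /andP[b1 b2] := vb k; have /andP[b3 b4] := vsb k.
  have [kA|kA] := boolP (k \in A).
    by have := crit k j; rewrite gj (_ : g k = 1) ?/g ?kA // => ?; split; lra.
  by have := crit k i; rewrite gi (_ : g k = 0) ?/g ?(negbTE kA) // => ?; split; lra.
have same_step Q u : is_transition_matrix Q ->
    (forall k, u k - stepop Q u k = f k) -> (forall k, u k = g k + u i) ->
    forall k, stepop Q g k = stepop P g k.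
  move=> hQ hu uE k; have := hu k; rewrite /f /lap {1}uE.
  rewrite (_ : u = fun k => g k + u i); last exact/funext.
  rewrite stepopD stepop_cst //; lra.
(* [stepop Q g k] is the sum of row [k] over [A], so it fixes the entry at [j] once the others
   agree. *)
have same_entry Q k : stepop Q g k = stepop P g k ->
    (forall l, l \in A -> l != j -> Q k l = P k l) -> Q k j = P k j.
  rewrite !gE !(bigD1 j jA) /= => h QP; move: h.
  by rewrite (eq_bigr (P k)) => [/addIr //|l /andP[lA nlj]]; exact: QP.
move=> k; split; last first.
  apply: same_entry => [|l lA nlj]; last by have [_ ->] := agr l lA nlj k.
  by apply: same_step hP' hv _ k => l; case: (both l).
(* Column [j] of the reversal is row [j] of [P'] up to positive weights. *)
have : reversal p P' k j = P k j.
  apply: same_entry => [|l lA nlj].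
    by apply: same_step hP's hvs _ k => l; case: (both l).
  have [e _] := agr l lA nlj k.
  by rewrite -[in RHS](reversible_reversal p_gt0 revP) /reversal e.
rewrite -[in RHS](reversible_reversal p_gt0 revP) /reversal.
move=> /divIf -/(_ (lt0r_neq0 (p_gt0 k)))/mulfI; apply; exact: lt0r_neq0.
Qed.

Hypothesis acyP : acyclic (edge P).

(** Induction on the size of the branch: vertices other than [j] lie in strictly smaller branches
    hanging off [j], and [cut_agree] then settles [j]. *)
Lemma branch_agree i j : edge P i j -> j != i ->
  (forall k, k \in branch (edge P) i j -> P k k = 0) ->
  forall k, k \in branch (edge P) i j -> agree k.
Proof.
have [n] := ubnP #|branch (edge P) i j|.
elim: n i j => // n IHn i j; rewrite ltnS => lebn eij nji diag0.
have inner_agree k : k \in branch (edge P) i j -> k != j -> agree k.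
  move=> kb nkj; have [c [ejc ncj nci kc]] := branch_split kb nkj.
  have pr := branch_proper acyP eij nji ejc ncj nci.
  apply: (IHn j c) => //; first exact: leq_trans (proper_card pr) lebn.
  by move=> l lc; apply: diag0; move/proper_sub/fintype.subsetP: pr; apply.
move=> k kb; have [->|] := eqVneq k j; last exact: inner_agree.
apply: (@cut_agree (branch (edge P) i j) i j) => //.
- exact: branch_id.
- exact: branch_root.
- by rewrite edge_symmetric.
- by apply: diag0; exact: branch_id.
- by move=> l m lb mb; exact: (branch_cut acyP eij nji lb mb).
Qed.

(** Every other vertex lies in the branch of a neighbour of the root [r]; this branch misses [r], so
    its diagonal entries vanish. *)
Lemma acyclic_unique r : (forall k, k != r -> P k k = 0) -> P = P'.
Proof.
move=> diag0.
have agr k : k != r -> agree k.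
  move=> nkr; have /connectP[s ps ek] := conP r k.
  move: nkr; rewrite {k}ek; case/shortenP: ps => -[|j t] /= pt ut _.
    by rewrite eqxx.
  move=> _; move: pt ut => /andP[erj pt] /andP[nrt ut].
  have njr : j != r by apply: contraNneq nrt => ->; rewrite mem_head.
  apply: (branch_agree erj njr).
    by move=> k kb; apply: diag0; apply: contraTneq kb => ->; exact: branch_root.
  by rewrite inE; apply/connectP; exists t => //; exact: path_avoid.
apply/funext => k; apply/funext => l.
have [->{k}|/agr/(_ l)[]//] := eqVneq k r.
have [->{l}|/agr/(_ r)[]//] := eqVneq l r.
(* The one remaining entry, at (r, r), follows from the row sums. *)
have := trans_sum1 hP' r; rewrite -(trans_sum1 hP r) !(bigD1 r isT) /=.
rewrite [X in _ + X = _](eq_bigr (P r)) => [/addIr //|l /agr/(_ r)[]//].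
Qed.

End Comparison.

(** * From asymptotic variances to the comparison of quadratic forms *)

Theorem theorem1 (R : realType) (I : finType) (p : I -> R)
    (P P' : I -> I -> R) (mu mu' : I -> R)
    (hp : is_distribution p)
    (hP : is_transition_matrix P) (irrP : irreducible P)
    (revP : reversible p P)
    (diagP : forall i j : I, P i i != 0 -> P j j != 0 -> i = j)
    (acyP : acyclic (edge P))
    (hP' : is_transition_matrix P') (irrP' : irreducible P')
    (invP' : invariant_distribution p P')
    (hmu : is_distribution mu) (hmu' : is_distribution mu')
    (hnu : forall f : I -> R,
       asymptotic_variance mu' f P' p <= asymptotic_variance mu f P p) :
  P = P'.
Proof.
have conP := irreducible_connect hP irrP.
have conP' := irreducible_connect hP' irrP'.
have invP : invariant_distribution p P.
  split=> // j; under eq_bigr do rewrite revP.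
  by rewrite -mulr_sumr trans_sum1 // mulr1.
(* Take f = [lap P g], with Poisson solutions [g] for [P] and [v] for [P']; the common term <f, f>
   cancels. *)
have dom g v : (forall i, lap P' v i = lap P g i) ->
    inner p (lap P g) v <= inner p (lap P g) g.
  move=> hv.
  have mean0 : mean p (lap P g) = 0.
    by rewrite -(lap_mean0 invP g); apply: eq_bigr => i _; rewrite mulrC.
  have := hnu (lap P g).
  rewrite (asymptotic_varianceE hP conP invP hmu (g := g)); last first.
    by move=> i; rewrite mean0 subr0.
  rewrite (asymptotic_varianceE hP' conP' invP' hmu' (g := v)); last first.
    by move=> i; rewrite mean0 subr0 -hv.
  rewrite !sum_step_variance //.
  under eq_bigr => i _ do rewrite -/(lap P' v i) hv.
  under [X in _ - X]eq_bigr => i _ do rewrite -/(lap P' v i) hv.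
  by rewrite lerD2r ler_pM2l.
(* The root is the state with non-zero diagonal entry if there is one, else any state; [I] is
   nonempty because [p] has mass 1. *)
have [r hr] : exists r, forall k, k != r -> P k k = 0.
  have [/existsP[r Prr]|/existsPn diag0] := boolP [exists r, P r r != 0].
    exists r => k; apply: contraNeq => Pkk; apply/eqP; exact: diagP.
  have [r|I0] := pickP (@predT I).
    by exists r => k _; apply/eqP; rewrite -[_ == _]negbK diag0.
  by move: hp.2; rewrite big_pred0 // => /eqP; rewrite eq_sym oner_eq0.
exact: (acyclic_unique hP conP revP invP hP' conP' invP' dom acyP hr).
Qed.
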